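(* Let $d\ge 2$ and let $\mathcal{T}$ be a conforming triangulation, consisting of $d$-simplices, of a domain $\Omega\subset\mathbb{R}^d$, with vertex set $\mathcal{V}$. Let $\mathcal{V}=\mathcal{V}_0\cup\mathcal{V}_1$ be any partition of $\mathcal{V}$ into two disjoint (possibly empty) subsets, and let $>_0$, $>_1$ be any total orderings of $\mathcal{V}_0$ and $\mathcal{V}_1$, respectively. Assign to every $T\in\mathcal{T}$ a vertex ordering and a type as follows. Let $k=\#(T\cap\mathcal{V}_1)$ be the number of vertices of $T$ lying in $\mathcal{V}_1$. (a) If $0\le k\le d$, let $w_1,\dots,w_k$ be the vertices of $T$ in $\mathcal{V}_1$, sorted with respect to $>_1$, and $v_0,v_1,\dots,v_{d-k}$ the vertices of $T$ in $\mathcal{V}_0$, sorted with respect to $>_0$, and set $$T=[v_0,w_1,\dots,w_k,v_1,\dots,v_{d-k}]_{t_T},\qquad t_T = k \bmod d .$$ (b) If $k=d+1$ (i.e. $T\cap\mathcal{V}_0=\emptyset$), set $T=[w_0,w_1,\dots,w_d]_0$, where $w_0,\dots,w_d$ are the vertices of $T$ sorted ascendingly with respect to $>_1$. Then the triangulation $\mathcal{T}$ with these vertex orderings and types is weakly compatible.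
   Context: Newest Vertex Bisection (NVB). A $d$-simplex is given with an ordering of its vertices and a type $t\in\{0,\dots,d-1\}$, written $T=[z_0,z_1,\dots,z_d]_t$. Its refinement edge is $\overline{z_0z_d}$, and bisecting it produces the two children $$T_0=\left[z_0,\tfrac{z_0+z_d}{2},z_1,\dots,z_{d-1}\right]_{(t+1)\bmod d},\qquad T_1=\left[z_d,\tfrac{z_0+z_d}{2},z_1,\dots,z_t,z_{d-1},\dots,z_{t+1}\right]_{(t+1)\bmod d}.$$ Refinement tree and NVB-equivalence. For a $d$-simplex $T$ with ordering and type, the refinement tree $\mathcal{RT}(T)$ is the rooted binary tree obtained from $d$ uniform NVB refinements of $T$ (each uniform refinement bisects all current descendants): its nodes are the refinement edges of $T$ and of its descendants, the root is the refinement edge of $T$, and the (unordered) two children of a node are the refinement edges of the two children of the corresponding simplex. It has levels $0,\dots,d-1$. Two $d$-simplices (same vertex set, possibly different ordering/type) are NVB-equivalent if their refinement trees coincide. Induced refinement of a face. If $F$ is a $(d-1)$-dimensional subsimplex of $T$, successive uniform NVB refinements of $T$ induce successive bisections of $F$ (a piece of $F$ is bisected whenever the refinement edge of the descendant of $T$ having that piece as a face lies in that piece). An ordering and type of $F$ (as a $(d-1)$-dimensional NVB simplex) is the ordering and type of $F$ within $T$ if this induced refinement is the NVB refinement of $F$ with that ordering and type; it is considered only up to NVB-equivalence. Conforming: the intersection of any two distinct elements is empty or a common subsimplex of both. Weakest compatibility condition: a triangulation $\mathcal{T}$ (each element with an ordering and type) satisfies it iff for any two neighbors $T,T'\in\mathcal{T}$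 with shared $(d-1)$-face $F=T\cap T'$, the ordering and type of $F$ within $T$ and within $T'$ coincide up to NVB-equivalence. Weakly compatible: $\mathcal{T}$ satisfies the weakest compatibility condition and there exists a finer triangulation (obtained from $\mathcal{T}$ by finitely many NVB bisections of elements) that is conforming and contains only elements of type $0$ or $1$. *)

(* Defs.v *)
From HB Require Import structures.
From mathcomp Require Import all_boot all_order all_algebra finmap.
From mathcomp Require Import all_classical all_reals topology normedtype.
Set Implicit Arguments.
Unset Strict Implicit.
Unset Printing Implicit Defensive.
Import Order.TTheory GRing.Theory Num.Theory.
Import numFieldNormedType.Exports.
Local Open Scope fset_scope.
Local Open Scope ring_scope.

(* Unordered simplices are represented by their finite sets of vertices. *)
Section Geometry.
Variables (R : numDomainType) (V : lmodType R).
Implicit Types (A F T : {fset V}) (P : {fset {fset V}}).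

Definition affinely_independent A : Prop :=
  forall a : V -> R, \sum_(v <- A) a v = 0 -> \sum_(v <- A) a v *: v = 0 ->
  forall v, v \in A -> a v = 0.

Definition is_simplex (n : nat) A : Prop :=
  #|` A| = n.+1 /\ affinely_independent A.

Definition hull A : set V :=
  [set x | exists a : V -> R,
     [/\ forall v, v \in A -> 0 <= a v,
         \sum_(v <- A) a v = 1 &
         x = \sum_(v <- A) a v *: v]]%classic.

(* F spans a common subsimplex of T and T' and fills their intersection. *)
Definition meet_in_face T T' F : Prop :=
  [/\ F != fset0, F `<=` T, F `<=` T' &
      (hull T `&` hull T' = hull F)%classic].

Definition conforming P : Prop :=
  forall T T', T \in P -> T' \in P -> T != T' ->
  (hull T `&` hull T' = set0)%classic \/ exists F, meet_in_face T T' F.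

End Geometry.

Section Domains.
Variables (R : realType) (d : nat).

Definition is_domain (Omega : set 'rV[R]_d) : Prop :=
  [/\ open Omega, connected Omega & (Omega !=set0)%classic].

Definition conforming_triangulation (Omega : set 'rV[R]_d)
    (P : {fset {fset 'rV[R]_d}}) : Prop :=
  [/\ forall T, T \in P -> is_simplex d T,
      closure Omega = [set x | exists2 T, T \in P & hull T x]%classic &
      conforming P].

End Domains.

(* [:: z_0; ...; z_n] together with t stands for [z_0, ..., z_n]_t. *)
Record nvb (V : Type) := NVB { vtx : seq V; ty : nat }.

Definition nvb_pair (V : Type) (T : nvb V) : seq V * nat := (vtx T, ty T).
Definition pair_nvb (V : Type) (p : seq V * nat) : nvb V := NVB p.1 p.2.
Lemma nvb_pairK (V : Type) : cancel (@nvb_pair V) (@pair_nvb V).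
Proof. by case. Qed.
HB.instance Definition _ (V : choiceType) :=
  Choice.copy (nvb V) (can_type (@nvb_pairK V)).

(* Binary trees, compared up to exchanging the two children of any node. *)
Inductive btree (E : Type) := Leaf | Node of E & btree E & btree E.
Arguments Leaf {E}.

Fixpoint btree_equiv (E : Type) (s s' : btree E) : Prop :=
  match s, s' with
  | Leaf, Leaf => True
  | Node e l r, Node e' l' r' =>
      e = e' /\ ((btree_equiv l l' /\ btree_equiv r r') \/
                 (btree_equiv l r' /\ btree_equiv r l'))
  | _, _ => False
  end.

Fixpoint prune (E : Type) (n : nat) (s : btree E) : btree E :=
  match n, s with
  | n'.+1, Node e l r => Node e (prune n' l) (prune n' r)
  | _, _ => Leaf
  end.

Section Bisection.
Variables (R : numFieldType) (V : lmodType R).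
Implicit Types (S T : nvb V) (F : {fset V}) (P Q : {fset nvb V}).

Definition nvb_dim T : nat := (size (vtx T)).-1.
Definition vset T : {fset V} := [fset v in vtx T].

Definition zfirst T : V := head 0 (vtx T).
Definition zlast T : V := last 0 (vtx T).
(* z_1, ..., z_{n-1} *)
Definition inner T : seq V := take (nvb_dim T).-1 (behead (vtx T)).
Definition midpt T : V := 2%:R^-1 *: (zfirst T + zlast T).
Definition edge T : {fset V} := [fset zfirst T; zlast T].

Definition child0 T : nvb V :=
  NVB [:: zfirst T, midpt T & inner T] ((ty T).+1 %% nvb_dim T).
Definition child1 T : nvb V :=
  NVB [:: zlast T, midpt T & take (ty T) (inner T) ++ rev (drop (ty T) (inner T))]
      ((ty T).+1 %% nvb_dim T).

Fixpoint edge_tree (n : nat) T : btree {fset V} :=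
  match n with
  | 0 => Leaf
  | n'.+1 => Node (edge T) (edge_tree n' (child0 T)) (edge_tree n' (child1 T))
  end.

Definition refinement_tree T : btree {fset V} := edge_tree (nvb_dim T) T.

Definition nvb_equiv S T : Prop :=
  vset S = vset T /\ btree_equiv (refinement_tree S) (refinement_tree T).

(* The bisections of the facet F of T induced by n uniform refinements of T.
   When F is not cut, exactly one child of T still has F as a face. The
   branches may have different lengths, since the pieces of F need not be
   bisected simultaneously. *)
Fixpoint induced_tree (n : nat) T F : btree {fset V} :=
  match n with
  | 0 => Leaf
  | n'.+1 =>
      if edge T `<=` F then
        Node (edge T)
          (induced_tree n' (child0 T) (midpt T |` (F `\ zlast T)))
          (induced_tree n' (child1 T) (midpt T |` (F `\ zfirst T)))
      else if F `<=` vset (child0 T) then induced_tree n' (child0 T) F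
      else induced_tree n' (child1 T) F
  end.

Definition nvb_on F S : Prop :=
  [/\ uniq (vtx S), vset S = F & (ty S < nvb_dim S)%N].

(* S is the ordering and type of F within T: to every depth L, the bisections
   of F induced by T are the newest vertex bisections of S. *)
Definition ordering_within T F S : Prop :=
  nvb_on F S /\
  forall L, exists n, btree_equiv (prune L (induced_tree n T F)) (edge_tree L S).

Definition weakest_compatibility P : Prop :=
  forall T T' F, T \in P -> T' \in P -> T != T' ->
  meet_in_face (vset T) (vset T') F -> #|` F| = nvb_dim T ->
  exists S S', [/\ ordering_within T F S, ordering_within T' F S' &
                   nvb_equiv S S'].

Inductive bisections P : {fset nvb V} -> Prop :=
| bisections_refl : bisections P P
| bisections_step Q T : bisections P Q -> T \in Q ->
    bisections P ((Q `\ T) `|` [fset child0 T; child1 T]).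

Definition weakly_compatible P : Prop :=
  weakest_compatibility P /\
  exists Q, [/\ bisections P Q, conforming [fset vset T | T in Q] &
                forall T, T \in Q -> ty T = 0%N \/ ty T = 1%N].

End Bisection.

Definition strict_total_on (V : eqType) (A : {pred V}) (gt : rel V) : Prop :=
  [/\ {in A, irreflexive gt}, {in A & &, transitive gt} &
      {in A &, forall x y, x != y -> gt x y || gt y x}].

Definition sort_asc (V : eqType) (gt : rel V) (s : seq V) : seq V :=
  sort (fun x y => (x == y) || gt y x) s.

(* For T with d+1 vertices, all of them in V0 `|` V1, the zfirst branch is
   k = #(T `&` V1) <= d and the second one is k = d+1. *)
Definition assign (V : choiceType) (d : nat) (V0 V1 : {fset V})
    (gt0 gt1 : rel V) (T : {fset V}) : nvb V :=
  let w := sort_asc gt1 (T `&` V1) in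
  if sort_asc gt0 (T `&` V0) is v0 :: v
  then NVB (v0 :: w ++ v) (#|` T `&` V1| %% d)
  else NVB w 0.

(* Main.v *)
Require Import Defs.
From mathcomp Require Import all_boot all_order all_algebra finmap.
From mathcomp Require Import all_classical all_reals topology normedtype.
From mathcomp Require Import lra zify.
(** The assigned elements have the form [c_0, M, c_1, ..., c_p] with c the sorted
    vertices in V_0 and M those in V_1. Bisection keeps this shape: it shortens c
    from one of its ends and puts the midpoint in front of M, and dropping a
    vertex of the list is the induced ordering of the opposite facet; so the
    ordering of a facet depends on the facet only.

    For the refinement, order the vertices of V_0 globally. The refinement edge
    of an element joins its first and last V_0-vertex, so the elements around a
    V_0-edge of maximal span all have that edge as refinement edge. Bisecting all
    of them is a stellar subdivision, which keeps the mesh conforming and leaves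
    fewer V_0-edges; when none is left, every element has type 0.

    Conformity together with affine independence is carried along as uniqueness
    of barycentric coordinates over the whole mesh. *)

Set Implicit Arguments.
Unset Strict Implicit.
Unset Printing Implicit Defensive.
Import Order.TTheory GRing.Theory Num.Theory.
Local Open Scope fset_scope.
Local Open Scope ring_scope.

(** * Barycentric coordinates over a mesh *)

Section Barycentric.
Variables (R : realFieldType) (V : lmodType R).
Implicit Types (T S : {fset V}) (P : {fset V} -> Prop) (f g : V -> R).

(** The coordinates are total functions vanishing off [T], so that coordinates over different
    simplices can be compared pointwise. *)
Definition barycentric f T (x : V) : Prop :=
  [/\ forall v, 0 <= f v, forall v, v \notin T -> f v = 0,
      \sum_(v <- T) f v = 1 & \sum_(v <- T) f v *: v = x].

(** For [T = T'] this is affine independence; for distinct elements it says that hulls meet only in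
    the hull of the common vertices. *)
Definition bary_unique P : Prop :=
  forall T T' f g x, P T -> P T' -> barycentric f T x -> barycentric g T' x ->
  f =1 g.

Lemma barycentric_sub f T S x :
  S `<=` T -> (forall v, v \notin S -> f v = 0) ->
  barycentric f T x <-> barycentric f S x.
Proof.
move=> sST f0.
have e1 : \sum_(v <- S) f v = \sum_(v <- T) f v.
  by apply: big_fset_incl => // v _ /f0.
have e2 : \sum_(v <- S) f v *: v = \sum_(v <- T) f v *: v.
  by apply: big_fset_incl => // v _ /f0 ->; rewrite scale0r.
rewrite /barycentric e1 e2; split=> -[f_ge0 fT s1 s2]; split=> //.
by move=> v vT; apply: f0; apply: contra vT; apply: (fsubsetP sST).
Qed.

Lemma hullP T x : hull T x <-> exists f, barycentric f T x.
Proof.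
split=> [[a [a_ge0 s1 ->]]|[f [f_ge0 f0 s1 <-]]]; last by exists f; split.
exists (fun v => if v \in T then a v else 0); split.
- by move=> v; case: ifP => // /a_ge0.
- by move=> v /negPf ->.
- by rewrite -s1; apply: eq_big_seq => v ->.
- by apply: eq_big_seq => v ->.
Qed.

Lemma hull_sub S T : S `<=` T -> (hull S `<=` hull T)%classic.
Proof.
move=> sST x /hullP [f Hf]; apply/hullP; exists f.
by apply/(barycentric_sub _ sST) => //; case: Hf.
Qed.

Lemma hull0 x : ~ hull (fset0 : {fset V}) x.
Proof.
by case=> a [_ /eqP]; rewrite big_seq_fset0 eq_sym oner_eq0.
Qed.

Lemma affinely_independent_bary_unique T f g x :
  affinely_independent T -> barycentric f T x -> barycentric g T x -> f =1 g.
Proof.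
move=> ind [_ f0 f1 fx] [_ g0 g1 gx] v.
have [vT|vT] := boolP (v \in T); last by rewrite f0 ?g0.
apply/eqP; rewrite -subr_eq0; apply/eqP.
apply: (ind (fun v => f v - g v)) vT; first by rewrite sumrB f1 g1 subrr.
rewrite -[RHS](subrr x) -{1}fx -gx -sumrB.
by apply: eq_bigr => u _; rewrite scalerBl.
Qed.

(** A point of two elements lies in the hull of their common face. Its coordinates over that face,
    padded with zeros, are coordinates over both elements, and affine independence identifies [f]
    and [g] with them. *)
Lemma conforming_bary_unique (Tr : {fset {fset V}}) :
  (forall T, T \in Tr -> affinely_independent T) -> conforming Tr ->
  bary_unique (fun T => T \in Tr).
Proof.
move=> ind conf T T' f g x TTr TTr' Hf Hg.
have [eqT|neqT] := eqVneq T T'.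
  by move: Hg; rewrite -eqT; apply: affinely_independent_bary_unique (ind _ _) Hf.
have xT : hull T x by apply/hullP; exists f.
have xT' : hull T' x by apply/hullP; exists g.
case: (conf _ _ TTr TTr' neqT) => [E|[F [_ FT FT' E]]].
  by have : (hull T `&` hull T')%classic x by []; rewrite E.
have /hullP[h Hh] : hull F x by rewrite -E.
have h0 v : v \notin F -> h v = 0 by case: Hh => _ + _ _; apply.
have HT : barycentric h T x by apply/(barycentric_sub _ FT).
have HT' : barycentric h T' x by apply/(barycentric_sub _ FT').
move=> v; rewrite (affinely_independent_bary_unique (ind _ _) Hf HT) //.
by rewrite (affinely_independent_bary_unique (ind _ _) Hg HT').
Qed.

(** Equal coordinates over [T] and [T'] are supported on the common vertices, so the common
    subsimplex is spanned by all of these. *)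
Lemma bary_unique_conforming (Tr : {fset {fset V}}) :
  bary_unique (fun T => T \in Tr) -> conforming Tr.
Proof.
move=> uniqTr T T' TTr TTr' _.
have E : (hull T `&` hull T' = hull (T `&` T')%fset)%classic.
  apply/seteqP; split=> [x [/hullP [f Hf] /hullP [g Hg]]|x xI]; last first.
    by split; apply: hull_sub xI; rewrite ?fsubsetIl ?fsubsetIr.
  have fg := uniqTr _ _ _ _ _ TTr TTr' Hf Hg.
  apply/hullP; exists f.
  apply/(barycentric_sub _ (fsubsetIl T T')) => // v.
  rewrite inE negb_and => /orP[vT|vT']; first by case: Hf => _ ->.
  by rewrite fg; case: Hg => _ ->.
have [E0|n0] := eqVneq (T `&` T') fset0; [left|right].
  by rewrite E E0 -subset0 => x /hull0.
by exists (T `&` T'); split; rewrite ?fsubsetIl ?fsubsetIr.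
Qed.

Lemma sum_delta (T : {fset V}) (a : V) : a \in T ->
  \sum_(v <- T) (v == a)%:R = 1 :> R.
Proof.
move=> aT; rewrite (big_fsetD1 a) //= eqxx big1_seq ?addr0 // => v /=.
by rewrite in_fsetD1 => /andP[/negPf ->].
Qed.

Lemma sum_delta_scale (T : {fset V}) (a : V) : a \in T ->
  \sum_(v <- T) (v == a)%:R *: v = a.
Proof.
move=> aT; rewrite (big_fsetD1 a) //= eqxx scale1r big1_seq ?addr0 // => v /=.
by rewrite in_fsetD1 => /andP[/negPf ->]; rewrite scale0r.
Qed.

Lemma barycentric_vertex T (a : V) : a \in T ->
  barycentric (fun v => (v == a)%:R) T a.
Proof.
move=> aT; split; [by move=> v; rewrite ler0n | | exact: sum_delta |
  exact: sum_delta_scale].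
by move=> v; case: eqP => // ->; rewrite aT.
Qed.

(** * Stellar subdivision at the midpoint of an edge *)

Definition mid (a b : V) : V := 2%:R^-1 *: (a + b).

(** Coordinates after eliminating the midpoint: its weight is handed over in halves to [a] and
    [b]. *)
Definition unbisect f (a b : V) (v : V) : R :=
  f v + f (mid a b) * (2%:R^-1 * (v == a)%:R + 2%:R^-1 * (v == b)%:R
                       - (v == mid a b)%:R).

Lemma barycentric_unbisect f T (a b : V) x :
  a \in T -> b \in T -> mid a b \notin T -> barycentric f (mid a b |` T) x ->
  barycentric (unbisect f a b) T x.
Proof.
set m := mid a b => aT bT mT [f_ge0 f0 s1 sx].
have am : (a == m) = false by apply: contraNF mT => /eqP <-.
have bm : (b == m) = false by apply: contraNF mT => /eqP <-.
have h0 v : v \notin T -> unbisect f a b v = 0.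
  move=> vT; rewrite /unbisect -/m.
  have -> : (v == a) = false by apply: contraNF vT => /eqP ->.
  have -> : (v == b) = false by apply: contraNF vT => /eqP ->.
  have [->|vm] := eqVneq v m; first by rewrite /= mulr0n mulr1n; lra.
  by rewrite f0 ?in_fset1U ?negb_or ?vm // /=; lra.
apply/(barycentric_sub _ (fsubsetU1 m T)) => //.
have aX : a \in m |` T by rewrite !inE aT orbT.
have bX : b \in m |` T by rewrite !inE bT orbT.
have mX : m \in m |` T by rewrite !inE eqxx.
split=> //.
- move=> v; rewrite /unbisect -/m; have := f_ge0 v; have := f_ge0 m.
  have [->|_] := eqVneq v m; first by rewrite [m == a]eq_sym [m == b]eq_sym am bm /= ?mulr0n ?mulr1n; lra.
  by case: eqP; case: eqP => _ _; rewrite /= ?mulr0n ?mulr1n; lra.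
- move=> v; rewrite in_fset1U negb_or => /andP[_]; exact: h0.
- rewrite big_split /= s1 -mulr_sumr sumrB big_split /= -!mulr_sumr.
  by rewrite !sum_delta //; lra.
- rewrite (eq_bigr (fun v => f v *: v + f m *: (2%:R^-1 *: ((v == a)%:R *: v)
     + 2%:R^-1 *: ((v == b)%:R *: v) - (v == m)%:R *: v))); last first.
    by move=> v _; rewrite /unbisect !scalerA -scalerDl -scalerBl scalerA -scalerDl.
  rewrite big_split /= sx -scaler_sumr sumrB big_split /= -!scaler_sumr.
  by rewrite !sum_delta_scale // -scalerDr subrr scaler0 addr0.
Qed.

Definition stellar P (a b : V) S : Prop :=
  (P S /\ ~~ ((a \in S) && (b \in S))) \/
  exists T, [/\ P T, a \in T, b \in T &
    S = mid a b |` (T `\ b) \/ S = mid a b |` (T `\ a)].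

(** Otherwise the midpoint would have coordinate 1 at itself over [T'], but at most 1/2 there when
    written as the mean of [a] and [b] over [T]. *)
Lemma mid_notin P (a b : V) T T' : bary_unique P -> P T -> a \in T -> b \in T ->
  a != b -> P T' -> mid a b \notin T'.
Proof.
move=> uP PT aT bT ab PT'; apply/negP => mT'.
have Hm := barycentric_vertex mT'.
have Hab : barycentric (fun v => 2%:R^-1 * (v == a)%:R + 2%:R^-1 * (v == b)%:R) T
    (mid a b).
  split.
  - by move=> v; do 2 case: eqP => _; rewrite /= ?mulr0n ?mulr1n; lra.
  - move=> v vT; have -> : (v == a) = false by apply: contraNF vT => /eqP ->.
    have -> : (v == b) = false by apply: contraNF vT => /eqP ->.
    by rewrite /= ?mulr0n; lra.
  - by rewrite big_split /= -!mulr_sumr !sum_delta //; lra.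
  - under eq_bigr do rewrite scalerDl -!scalerA.
    by rewrite big_split /= -!scaler_sumr !sum_delta_scale // -scalerDr.
have /= := uP _ _ _ _ _ PT' PT Hm Hab (mid a b); rewrite eqxx.
have [->|_] := eqVneq (mid a b) a; first by rewrite (negPf ab) /= ?mulr0n ?mulr1n; lra.
by case: eqP => _; rewrite /= ?mulr0n ?mulr1n; lra.
Qed.

(** Eliminating the midpoint leads back to the old mesh, where coordinates are unique. Every element
    of the new mesh lacks [a] or [b], so the weight of the midpoint is twice the smaller of the old
    coordinates at [a] and [b]; it is thus determined, and with it all other coordinates. *)
Lemma bary_unique_stellar P (a b : V) T0 : bary_unique P ->
  P T0 -> a \in T0 -> b \in T0 -> a != b -> bary_unique (stellar P a b).
Proof.
move=> uP PT0 aT0 bT0 ab.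
have mP T : P T -> mid a b \notin T := mid_notin uP PT0 aT0 bT0 ab.
have key S f x : stellar P a b S -> barycentric f S x ->
    exists T, [/\ P T, barycentric (unbisect f a b) T x, forall v, 0 <= f v &
                  f a = 0 \/ f b = 0].
  case=> [[PS nab]|[T [PT aT bT ES]]] Hf.
    exists S; case: (Hf) => f_ge0 f0 _ _.
    have E : unbisect f a b = f.
      apply/funext => v; rewrite /unbisect (f0 (mid a b)) ?mul0r ?addr0 //.
      exact: mP.
    split=> //; first by rewrite E.
    by move: nab; rewrite negb_and => /orP[/f0|/f0]; [left|right].
  have mT := mP _ PT.
  have am : (a == mid a b) = false by apply: contraNF mT => /eqP <-.
  have bm : (b == mid a b) = false by apply: contraNF mT => /eqP <-.
  exists T; case: (Hf) => f_ge0 f0 _ _; split=> //.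
    apply: barycentric_unbisect => //.
    apply/(barycentric_sub _ (S := S)) => //.
    by case: ES => ->; apply: fsetUS; exact: fsubD1set.
  by case: ES => E; [right|left]; apply: f0; rewrite E !inE eqxx ?am ?bm.
move=> S S' f g x /key keyS /key keyS' /keyS [T [PT Hf f_ge0 fab]].
move=> /keyS' [T' [PT' Hg g_ge0 gab]] v.
have E := uP _ _ _ _ _ PT PT' Hf Hg.
have mT0 := mP _ PT0.
have am : (a == mid a b) = false by apply: contraNF mT0 => /eqP <-.
have bm : (b == mid a b) = false by apply: contraNF mT0 => /eqP <-.
have ba : (b == a) = false by rewrite eq_sym (negPf ab).
have := E v; have := E a; have := E b; rewrite /unbisect !eqxx am bm ba (negPf ab).
rewrite /= => Eb Ea.
have Em : f (mid a b) = g (mid a b).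
  have := f_ge0 a; have := f_ge0 b; have := g_ge0 a; have := g_ge0 b.
  by case: fab => fz; case: gab => gz; move: Ea Eb; rewrite fz gz; lra.
by rewrite Em => /addIr.
Qed.

End Barycentric.

(** * Newest vertex bisection of split simplices *)

Lemma btree_equiv_refl (E : Type) (s : btree E) : btree_equiv s s.
Proof. by elim: s => //= e l IHl r IHr; split=> //; left. Qed.

Lemma btree_equiv_trans (E : Type) (s t u : btree E) :
  btree_equiv s t -> btree_equiv t u -> btree_equiv s u.
Proof.
elim: s t u => [|e l IHl r IHr] [|e1 l1 r1] [|e2 l2 r2] //=.
move=> [-> h1] [-> h2]; split=> //.
by case: h1 h2 => -[p q] [] [p' q']; [left|right|right|left]; split;
  by [apply: IHl p _ | apply: IHr q _].
Qed.

Section SplitNvb.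
Variables (R : realFieldType) (V : lmodType R).
Implicit Types (C M s : seq V) (a b x : V).

(* The simplex [c_0, M, c_1, ..., c_p] with c = C: the bisection eats up C
   from its two ends and puts the midpoints in front of M.  Once C is used up
   (p = 0) a new cycle starts, with the type reset to 0. *)
Definition split_nvb C M : nvb V :=
  NVB (take 1 C ++ M ++ behead C) (if (1 < size C)%N then size M else 0).

Lemma vtx_split C M : perm_eq (vtx (split_nvb C M)) (C ++ M).
Proof.
case: C => [|a s] /=; first by rewrite cats0.
by rewrite take0 /= perm_cons perm_catC.
Qed.

Lemma in_vset_split C M v : (v \in vset (split_nvb C M)) = (v \in C ++ M).
Proof. by rewrite in_fset (perm_mem (vtx_split C M)). Qed.

Lemma nvb_dim_split C M : nvb_dim (split_nvb C M) = (size (C ++ M)).-1.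
Proof. by rewrite /nvb_dim (perm_size (vtx_split C M)). Qed.

(** The turn of the cycle: both sides have type 0 and the same vertex list, so an exhausted [C] can
    be refilled with all vertices. *)
Lemma split_nvb_small C M : (size C <= 1)%N ->
  split_nvb C M = split_nvb (C ++ M) [::].
Proof.
rewrite /split_nvb; case: C => [|a [|b s]] //= _.
  by rewrite cats0; case: M => //= a M; rewrite take0 /=; case: ifP.
by rewrite take0 /= cats0; case: ifP.
Qed.

Lemma zfirst_split a s M : zfirst (split_nvb (a :: s) M) = a.
Proof. by []. Qed.

Lemma zlast_split a s b M : zlast (split_nvb (a :: rcons s b) M) = b.
Proof. by rewrite /zlast /= take0 /= last_cat last_rcons. Qed.

Lemma edge_split a s b M : edge (split_nvb (a :: rcons s b) M) = [fset a; b].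
Proof. by rewrite /edge zlast_split. Qed.

Lemma midpt_split a s b M : midpt (split_nvb (a :: rcons s b) M) = mid a b.
Proof. by rewrite /midpt zlast_split. Qed.

Lemma midC a b : mid a b = mid b a.
Proof. by rewrite /mid addrC. Qed.

Lemma inner_split a s b M : inner (split_nvb (a :: rcons s b) M) = M ++ s.
Proof.
rewrite /inner nvb_dim_split /= take0 /= -cats1 catA take_size_cat //.
by rewrite !size_cat addn1 addSn addnC.
Qed.

(** The dimension is [size s + size M + 1], so the increased type wraps around to 0 exactly when [s]
    is empty, that is, when the child has a single vertex left in [C]. *)
Lemma ty_child a s b M :
  ((ty (split_nvb (a :: rcons s b) M)).+1 %%
     nvb_dim (split_nvb (a :: rcons s b) M))%N =
  if (1 < (size s).+1)%N then (size M).+1 else 0%N.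
Proof.
rewrite nvb_dim_split /= !size_rcons /= size_cat size_rcons.
case: ltnP => h; first by rewrite modn_small //; lia.
by move: h; rewrite ltnS leqn0 => /eqP ->; rewrite add1n modnn.
Qed.

Lemma child0_split a s b M :
  child0 (split_nvb (a :: rcons s b) M) = split_nvb (a :: s) (mid a b :: M).
Proof.
rewrite /child0 ty_child inner_split midpt_split zfirst_split.
by rewrite /split_nvb /= take0.
Qed.

(** As the type equals [size M], the reversal in the second child leaves [M] alone and reverses
    exactly [s]. *)
Lemma child1_split a s b M :
  child1 (split_nvb (a :: rcons s b) M) =
  split_nvb (b :: rev s) (mid a b :: M).
Proof.
rewrite /child1 ty_child inner_split midpt_split zlast_split.
rewrite /split_nvb /= take0 /= size_rcons /= size_rev.
by rewrite take_size_cat // drop_size_cat.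
Qed.

(** Reversing [C] only exchanges the two children, and trees are compared up to this exchange. *)
Lemma edge_tree_rev n C M :
  btree_equiv (edge_tree n (split_nvb (rev C) M)) (edge_tree n (split_nvb C M)).
Proof.
case: n C => // n [|a C]; first exact: btree_equiv_refl.
case/lastP: C => [|s b]; first exact: btree_equiv_refl.
rewrite rev_cons rev_rcons rcons_cons /= !edge_split !child0_split !child1_split.
rewrite revK midC fsetUC; split=> //; right; split; exact: btree_equiv_refl.
Qed.

Notation unique1 T := (bary_unique (eq (vset T))).

Lemma bary_unique_sub (P Q : {fset V} -> Prop) : (forall S, Q S -> P S) ->
  bary_unique P -> bary_unique Q.
Proof. by move=> QP uP T T' f g x /QP PT /QP; apply: uP. Qed.

Lemma vset_child0 a s b M : uniq ((a :: rcons s b) ++ M) ->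
  vset (split_nvb (a :: s) (mid a b :: M)) =
  mid a b |` (vset (split_nvb (a :: rcons s b) M) `\ b).
Proof.
move=> U; apply/fsetP => v.
rewrite in_fset1U in_fsetD1 !in_vset_split !mem_cat !inE mem_rcons inE.
have [->|_] /= := eqVneq v (mid a b); first by rewrite !orbT.
have [->|_] //= := eqVneq v b.
move: U; rewrite /= cat_rcons mem_cat inE !negb_or cat_uniq /=.
case/andP=> /and3P[_ /negPf + _] /and3P[_ + /andP[/negPf-> _]].
by rewrite eq_sym negb_or => -> /andP[/negPf -> _].
Qed.

Lemma vset_child1 a s b M : uniq ((a :: rcons s b) ++ M) ->
  vset (split_nvb (b :: rev s) (mid a b :: M)) =
  mid a b |` (vset (split_nvb (a :: rcons s b) M) `\ a).
Proof.
move=> U; apply/fsetP => v.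
rewrite in_fset1U in_fsetD1 !in_vset_split !mem_cat !inE mem_rcons inE mem_rev.
have [->|_] /= := eqVneq v (mid a b); first by rewrite !orbT.
have [->|_] //= := eqVneq v a.
by move: U; rewrite /= mem_cat mem_rcons inE => /andP[/negPf ->].
Qed.

(** Affine independence is stated as uniqueness of coordinates for the mesh with this single
    element, the form that stellar subdivision passes on to children. *)
Definition good C M := uniq (C ++ M) /\ unique1 (split_nvb C M).

Lemma good_mid a s b M : good (a :: rcons s b) M ->
  mid a b \notin (a :: rcons s b) ++ M.
Proof.
move=> [U uT]; rewrite -in_vset_split.
apply: (mid_notin uT erefl _ _ _ erefl); rewrite ?in_vset_split.
- by rewrite inE eqxx.
- by rewrite mem_cat inE mem_rcons inE eqxx orbT.
- by move: U; rewrite /= mem_cat mem_rcons inE !negb_or => /andP[/andP[/andP[]]].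
Qed.

Lemma good_unique1_child a s b M T' : good (a :: rcons s b) M ->
  T' = split_nvb (a :: s) (mid a b :: M) \/
  T' = split_nvb (b :: rev s) (mid a b :: M) -> unique1 T'.
Proof.
move=> [U uT] HT'.
have aT : a \in vset (split_nvb (a :: rcons s b) M).
  by rewrite in_vset_split inE eqxx.
have bT : b \in vset (split_nvb (a :: rcons s b) M).
  by rewrite in_vset_split mem_cat inE mem_rcons inE eqxx orbT.
have ab : a != b.
  by move: U; rewrite /= mem_cat mem_rcons inE !negb_or => /andP[/andP[/andP[]]].
apply: bary_unique_sub (bary_unique_stellar uT erefl aT bT ab) => S <-.
right; exists (vset (split_nvb (a :: rcons s b) M)); split=> //.
by case: HT' => ->; [left; exact: vset_child0|right; exact: vset_child1].
Qed.

Lemma good_child0 a s b M : good (a :: rcons s b) M ->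
  good (a :: s) (mid a b :: M).
Proof.
move=> G; split; last by apply: good_unique1_child G _; left.
case: (G) (good_mid G) => U _ mN.
have : uniq (mid a b :: a :: rcons s b ++ M) by rewrite cons_uniq mN U.
rewrite -!cat_cons -cat1s -cats1 => U'.
have : uniq ((mid a b :: a :: s) ++ M).
  apply: subseq_uniq U'; rewrite /= !eqxx -catA.
  by rewrite subseq_cat2l; exact: suffix_subseq.
by rewrite (perm_uniq (_ : perm_eq _ ((a :: s) ++ mid a b :: M))) // perm_sym
  perm_catC /= perm_cons perm_catC.
Qed.

Lemma good_rev C M : good C M -> good (rev C) M.
Proof.
move=> [U uT]; split; first by
  rewrite (perm_uniq (_ : perm_eq _ (C ++ M))) // perm_cat2r perm_rev.
apply: bary_unique_sub uT => S <-; apply/fsetP => v.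
by rewrite !in_vset_split !mem_cat mem_rev.
Qed.

Lemma good_child1 a s b M : good (a :: rcons s b) M ->
  good (b :: rev s) (mid a b :: M).
Proof.
move=> /good_rev; rewrite rev_cons rev_rcons rcons_cons => /good_child0.
by rewrite midC.
Qed.

Lemma good_small C M : (size C <= 1)%N -> good C M -> good (C ++ M) [::].
Proof.
by move=> C1 [U uT]; split; [rewrite cats0 | rewrite -split_nvb_small].
Qed.

(** * The refinement induced on a facet *)

Definition facet_nvb C M x :=
  split_nvb ([seq v <- C | v != x]) ([seq v <- M | v != x]).

Definition induced_ok L n C M x :=
  btree_equiv (prune L (induced_tree n (split_nvb C M)
                          (vset (split_nvb C M) `\ x)))
    (edge_tree L (facet_nvb C M x)).

(** When [x] is not on the refinement edge, deleting it leaves both ends of [C] in place: simplex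
    and facet are bisected at the same edge, and the halves of the facet are the facets opposite [x]
    of the two children. The first premise is the induction hypothesis of [induced_okW]. *)
Lemma induced_ok_cut L n a s b M x :
  (forall C M x, good C M -> (3 <= size (C ++ M))%N -> x \in C ++ M ->
     induced_ok L n C M x) ->
  good (a :: rcons s b) M -> (3 <= size ((a :: rcons s b) ++ M))%N ->
  x \in (a :: rcons s b) ++ M -> x != a -> x != b ->
  induced_ok L.+1 n.+1 (a :: rcons s b) M x.
Proof.
move=> IH G sz xin xa xb.
have mN := good_mid G; have [U _] := G.
have xm : x != mid a b by apply: contraTneq xin => ->.
rewrite /induced_ok.
set T := split_nvb _ _; set F := vset T `\ x.
have eF : edge T `<=` F.
  apply/fsubsetP => v; rewrite edge_split in_fset2 in_fsetD1 => /orP[]/eqP ->.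
    by rewrite eq_sym xa in_vset_split inE eqxx.
  by rewrite eq_sym xb in_vset_split mem_cat inE mem_rcons inE eqxx orbT.
have eS : facet_nvb (a :: rcons s b) M x =
    split_nvb (a :: rcons ([seq v <- s | v != x]) b) ([seq v <- M | v != x]).
  by rewrite /facet_nvb /= filter_rcons /= ![_ == x]eq_sym xa xb.
rewrite eS /= eF /= !edge_split !child0_split !child1_split.
split=> //; left; rewrite /T midpt_split zlast_split zfirst_split -/T.
split.
- have -> : mid a b |` (F `\ b) = vset (split_nvb (a :: s) (mid a b :: M)) `\ x.
    rewrite vset_child0 // /F -/T; apply/fsetP => v; rewrite !inE.
    by have [->|] /= := eqVneq v (mid a b); rewrite ?[_ == x]eq_sym ?xm //= andbCA.
  have := IH (a :: s) (mid a b :: M) x (good_child0 G).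
  rewrite /induced_ok /facet_nvb /= ![_ == x]eq_sym xa xm; apply.
    by move: sz; rewrite /= !size_cat /= size_rcons; lia.
  by move: xin; rewrite !(mem_cat, inE, mem_rcons) (negPf xa) (negPf xb) (negPf xm).
- have -> : mid a b |` (F `\ a) = vset (split_nvb (b :: rev s) (mid a b :: M)) `\ x.
    rewrite vset_child1 // /F -/T; apply/fsetP => v; rewrite !inE.
    by have [->|] /= := eqVneq v (mid a b); rewrite ?[_ == x]eq_sym ?xm //= andbCA.
  have := IH (b :: rev s) (mid a b :: M) x (good_child1 G).
  rewrite /induced_ok /facet_nvb /= ![_ == x]eq_sym xb xm filter_rev; apply.
    by move: sz; rewrite /= !size_cat /= size_rcons size_rev; lia.
  by move: xin; rewrite !(mem_cat, inE, mem_rcons, mem_rev) (negPf xa) (negPf xb)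
    (negPf xm).
Qed.

Lemma facet_nvb_small C M x : (size C <= 1)%N ->
  facet_nvb C M x = facet_nvb (C ++ M) [::] x.
Proof.
move=> C1; rewrite /facet_nvb split_nvb_small ?filter_cat //.
by rewrite size_filter (leq_trans (count_size _ _)).
Qed.

Lemma induced_ok_small L n C M x : (size C <= 1)%N ->
  induced_ok L n (C ++ M) [::] x -> induced_ok L n C M x.
Proof.
move=> C1; rewrite /induced_ok -(split_nvb_small M C1).
by rewrite -(facet_nvb_small M x C1).
Qed.

(* If the facet is missed by a bisection, it is opposite to the new midpoint m,
   which does not lie on the next refinement edge: the next bisection cuts. *)
Lemma induced_ok_newest L n a s m M :
  (forall C M x, good C M -> (3 <= size (C ++ M))%N -> x \in C ++ M ->
     induced_ok L n C M x) ->
  good (a :: s) (m :: M) -> (3 <= size ((a :: s) ++ m :: M))%N ->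
  induced_ok L.+1 n.+1 (a :: s) (m :: M) m.
Proof.
move=> IH G sz; have [U _] := G.
have min : m \in (a :: s) ++ m :: M by rewrite !(mem_cat, inE) eqxx !orbT.
have ma : m != a.
  by apply: contraTneq U => ->; rewrite /= !(mem_cat, inE) eqxx !orbT.
case/lastP: s G sz U min => [|s b] G sz U min; last first.
  apply: induced_ok_cut => //.
  apply: contraTneq U => ->.
  by rewrite cat_uniq /= !(inE, mem_rcons) eqxx !(orbT, andbF).
(* Only [a] is left in [C], so a new cycle starts with the list [a, m, M]. With at least three
   vertices [M] is nonempty, and its last vertex rather than [m] ends the refinement edge. *)
apply: (@induced_ok_small _ _ [:: a]) => //; case/lastP: M G sz U min => [|M b] // G sz U min.
apply: (induced_ok_cut (s := m :: M)) => //=.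
- exact: (@good_small [:: a]).
- by move: sz; rewrite /= cats0.
- by move: min; rewrite /= cats0.
- apply: contraTneq U => ->.
  by rewrite /= !(inE, mem_cat, mem_rcons) eqxx !(orbT, andbF).
Qed.

Lemma vset_facet C M x :
  vset (facet_nvb C M x) = vset (split_nvb C M) `\ x.
Proof.
apply/fsetP => v; rewrite in_fsetD1 /facet_nvb !in_vset_split !mem_cat.
by rewrite !mem_filter andb_orr.
Qed.

Lemma filter_neq_id C x : x \notin C -> [seq v <- C | v != x] = C.
Proof.
by move=> xC; apply/all_filterP/allP => v; apply: contraTneq => ->.
Qed.

Lemma good_ends a s b M : good (a :: rcons s b) M ->
  [/\ a != b, a \notin s ++ M & b \notin s ++ M].
Proof.
case=> U _; move: (U).
rewrite (perm_uniq (_ : perm_eq _ (a :: b :: s ++ M))); last first.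
  by rewrite /= perm_cons cat_rcons; exact: permEl (perm_catCA s [:: b] M).
by rewrite /= inE negb_or => /andP[/andP[-> ->] /andP[->]].
Qed.

(** The facet opposite [b] is not cut: it is the facet of the first child opposite the new midpoint,
    and both deletions leave the same lists. One level of the simplex is spent and none of the
    facet. *)
Lemma induced_ok_skip0 L n a s b M : good (a :: rcons s b) M ->
  induced_ok L n (a :: s) (mid a b :: M) (mid a b) ->
  induced_ok L n.+1 (a :: rcons s b) M b.
Proof.
move=> G; have [U _] := G; have mN := good_mid G.
have [ab aN bN] := good_ends G.
have eF : vset (split_nvb (a :: rcons s b) M) `\ b =
          vset (split_nvb (a :: s) (mid a b :: M)) `\ mid a b.
  rewrite vset_child0 //; apply/fsetP => v; rewrite !(in_fsetD1, in_fset1U).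
  have [->|] //= := eqVneq v (mid a b).
  by rewrite in_vset_split (negPf mN) andbF.
have eS : facet_nvb (a :: rcons s b) M b =
          facet_nvb (a :: s) (mid a b :: M) (mid a b).
  rewrite /facet_nvb /= filter_rcons ab !eqxx /=.
  move: mN bN; rewrite !(mem_cat, inE, mem_rcons) !negb_or.
  move=> /andP[/andP[ma /andP[_ ms]] mM] /andP[bs bM].
  by rewrite !filter_neq_id // eq_sym ma.
rewrite /induced_ok eS /=.
rewrite (_ : edge _ `<=` _ = false); last first.
  by apply/negP => /fsubsetP/(_ b); rewrite edge_split in_fset2 in_fsetD1 !eqxx orbT => /(_ isT).
by rewrite child0_split eF fsubD1set.
Qed.

(** Symmetric to [induced_ok_skip0], except that the second child delivers the list of the facet
    reversed, which [edge_tree_rev] repairs. *)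
Lemma induced_ok_skip1 L n a s b M : good (a :: rcons s b) M ->
  induced_ok L n (b :: rev s) (mid a b :: M) (mid a b) ->
  induced_ok L n.+1 (a :: rcons s b) M a.
Proof.
move=> G; have [U _] := G; have mN := good_mid G.
have [ab aN bN] := good_ends G.
have eF : vset (split_nvb (a :: rcons s b) M) `\ a =
          vset (split_nvb (b :: rev s) (mid a b :: M)) `\ mid a b.
  rewrite vset_child1 //; apply/fsetP => v; rewrite !(in_fsetD1, in_fset1U).
  have [->|] //= := eqVneq v (mid a b).
  by rewrite in_vset_split (negPf mN) andbF.
have eS : facet_nvb (b :: rev s) (mid a b :: M) (mid a b) =
    split_nvb (rev [seq v <- a :: rcons s b | v != a]) [seq v <- M | v != a].
  rewrite /facet_nvb /= filter_rcons (eq_sym b a) ab !eqxx /= rev_rcons.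
  move: mN aN; rewrite !(mem_cat, inE, mem_rcons) !negb_or.
  move=> /andP[/andP[_ /andP[mb ms]] mM] /andP[as_ aM].
  by rewrite !filter_neq_id ?mem_rev // eq_sym mb.
rewrite /induced_ok eS /= => H; apply: btree_equiv_trans (edge_tree_rev _ _ _).
move: H.
rewrite (_ : edge _ `<=` _ = false); last first.
  by apply/negP => /fsubsetP/(_ a); rewrite edge_split in_fset2 in_fsetD1 !eqxx => /(_ isT).
(* The induced tree tries the first child first; the facet contains [b] and hence does not lie in
   it. *)
rewrite child0_split child1_split (_ : _ `<=` vset (split_nvb (a :: s) _) = false).
  by rewrite eF.
apply/negP => /fsubsetP/(_ b); rewrite in_fsetD1 !in_vset_split.
rewrite eq_sym ab !(mem_cat, inE, mem_rcons) eqxx /= orbT /= => /(_ isT).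
move: bN mN; rewrite !(mem_cat, inE, mem_rcons) !negb_or (eq_sym b) (eq_sym b).
by move=> /andP[/negPf-> /negPf->] /andP[/andP[_ /andP[/negPf mb _]] _]; rewrite (negPf ab) mb.
Qed.

(** Two bisections of the simplex suffice for one of the facet, since a bisection missing the facet
    is followed by one that cuts it ([induced_ok_newest]). *)
Lemma induced_okW L n C M x : good C M -> (3 <= size (C ++ M))%N ->
  x \in C ++ M -> (2 * L <= n)%N -> induced_ok L n C M x.
Proof.
elim: L n C M x => [|L IH] n C M x G sz xin; first by case: n.
have {}IH k : (2 * L <= k)%N -> forall C M x, good C M ->
  (3 <= size (C ++ M))%N -> x \in C ++ M -> induced_ok L k C M x.
  by move=> hk C' M' x' *; apply: IH.
(* An exhausted [C] is refilled, so that the refinement edge joins its two ends. *)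
wlog C2 : C M G sz xin / (1 < size C)%N => [wlogC|].
  have [C1|] := ltnP 1 (size C); first exact: wlogC.
  move=> C1 Ln; apply: induced_ok_small => //.
  apply: wlogC; rewrite ?cats0 //; first exact: good_small.
  by apply: leq_trans sz.
rewrite mulnS => Ln.
case: n Ln => [|[|n]] //; rewrite !ltnS => Ln.
case: C C2 G sz xin => [|a C] //; case/lastP: C => [|s b] // _ G sz xin.
have Ln1 : (2 * L <= n.+1)%N by apply: leq_trans Ln _.
have [xa|xa] := eqVneq x a; last first.
  have [xb|xb] := eqVneq x b; last exact: induced_ok_cut (IH _ Ln1) _ _ _ _ _.
  rewrite xb; apply: induced_ok_skip0 => //.
  apply: induced_ok_newest (IH _ Ln) (good_child0 G) _.
  by move: sz; rewrite /= !size_cat /= size_rcons; lia.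
rewrite xa; apply: induced_ok_skip1 => //.
apply: induced_ok_newest (IH _ Ln) (good_child1 G) _.
by move: sz; rewrite /= !size_cat /= size_rcons size_rev; lia.
Qed.

Lemma ordering_within_split C M x : good C M -> (3 <= size (C ++ M))%N ->
  x \in C ++ M ->
  ordering_within (split_nvb C M) (vset (split_nvb C M) `\ x) (facet_nvb C M x).
Proof.
move=> G sz xin; split; last by move=> L; exists (2 * L)%N; apply: induced_okW.
have [U _] := G.
have szF : size ([seq v <- C | v != x] ++ [seq v <- M | v != x]) =
    (size (C ++ M)).-1.
  by rewrite -filter_cat -rem_filter // size_rem.
split; rewrite ?vset_facet //.
  by rewrite (perm_uniq (vtx_split _ _)) -filter_cat filter_uniq.
rewrite nvb_dim_split /=; case: (ltnP 1 (size [seq v <- C | v != x])) => [|_]; last by rewrite szF; lia.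
by move=> h; rewrite size_cat -ltnS; move: h; set p := size _; set q := size _ => h; lia.
Qed.

End SplitNvb.

(** * Refinement along edges of maximal span *)

Lemma seq_argmax (T : eqType) (p : pred T) (f : T -> nat) (s : seq T) :
  has p s -> exists2 x, x \in s & p x /\ {in s, forall y, p y -> (f y <= f x)%N}.
Proof.
elim: s => //= x s IHs.
have [/IHs [y ys [py ymax]] _|ns] := boolP (has p s).
  have [lefxy|ltfyx] := leqP (f x) (f y).
    exists y; first by rewrite inE ys orbT.
    by split=> // z; rewrite inE => /predU1P[-> //|/ymax].
  have [px|npx] := boolP (p x); last first.
    exists y; first by rewrite inE ys orbT.
    by split=> // z; rewrite inE => /predU1P[->|/ymax //]; rewrite (negPf npx).
  exists x; rewrite ?inE ?eqxx //; split=> // z; rewrite inE => /predU1P[-> //|zs pz].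
  exact: leq_trans (ymax _ zs pz) (ltnW ltfyx).
rewrite orbF => px; exists x; rewrite ?inE ?eqxx //; split=> // z.
rewrite inE => /predU1P[-> //|zs pz].
by case/hasP: ns; exists z.
Qed.

Lemma fset_ltn_card (K : choiceType) (A B : {fset K}) x :
  A `<=` B -> x \in B -> x \notin A -> (#|` A| < #|` B|)%N.
Proof.
move=> sAB xB xA; apply: fproper_ltn_card; rewrite fproperE sAB.
by apply: contra xA => /fsubsetP; apply.
Qed.

(** * Bisecting all elements of a given kind *)

Section Bisections.
Variables (R : realFieldType) (V : lmodType R).
Implicit Types (P Q : {fset nvb V}) (T : nvb V).

Lemma bisections_trans P Q S : bisections P Q -> bisections Q S ->
  bisections P S.
Proof.
move=> PQ; elim: S / => // S T QS PS TS.
exact: bisections_step PS TS.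
Qed.

(** Bad elements are bisected one at a time. Since their children are not bad, the number of bad
    elements drops and only original elements are ever bisected. *)
Lemma bisect_all P (bad : pred (nvb V)) :
  (forall T, T \in P -> bad T -> ~~ bad (child0 T) /\ ~~ bad (child1 T)) ->
  exists2 Q, bisections P Q & forall S, S \in Q <->
    (S \in P /\ ~~ bad S) \/
    exists2 T, T \in P /\ bad T & S = child0 T \/ S = child1 T.
Proof.
have inB P0 S : (S \in [fset T in P0 | bad T]) = (S \in P0) && bad S.
  by rewrite !inE.
have [n] := ubnP #|` [fset T in P | bad T]|.
elim: n P => // n IHn P ltPn badP.
have [|none] := boolP (has bad P); last first.
  exists P; first exact: bisections_refl.
  move=> S; split=> [SP|[[]//|[T [TP bT]]]].
    by left; split=> //; apply: contra none => bS; apply/hasP; exists S.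
  by case/hasP: none; exists T.
case/hasP => T TP bT; have [nb0 nb1] := badP _ TP bT.
set P1 := (P `\ T) `|` [fset child0 T; child1 T].
have inP1 S : S \in P1 -> bad S -> S \in P `\ T.
  by rewrite in_fsetU in_fset2 => /orP[//|/orP[]/eqP ->]; rewrite ?(negPf nb0) ?(negPf nb1).
have [||Q P1Q HQ] := IHn P1.
- rewrite -ltnS; apply: leq_trans ltPn; rewrite ltnS.
  apply: (@fset_ltn_card _ _ _ T).
  - apply/fsubsetP => S.
    by rewrite !inB => /andP[SP1 bS]; have := inP1 _ SP1 bS; rewrite in_fsetD1 bS => /andP[_ ->].
  - by rewrite inB TP bT.
  - rewrite inB bT andbT.
    by apply/negP => /inP1/(_ bT); rewrite in_fsetD1 eqxx.
- by move=> S SP1 bS; have := inP1 _ SP1 bS; rewrite in_fsetD1 => /andP[_ SP]; apply: badP.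
exists Q; first by apply: bisections_trans P1Q; apply: bisections_step TP; exact: bisections_refl.
move=> S; rewrite HQ; split.
  case=> [[SP1 nbS]|[T' [T'P1 bT'] E]].
    move: SP1; rewrite in_fsetU in_fset2 in_fsetD1 => /orP[/andP[_ SP]|]; first by left.
    by case/orP => /eqP E; right; exists T => //; [left|right].
  have := inP1 _ T'P1 bT'; rewrite in_fsetD1 => /andP[_ T'P].
  by right; exists T'.
case=> [[SP nbS]|[T' [T'P bT'] E]].
  left; split=> //; rewrite in_fsetU in_fsetD1 SP andbT.
  by have [ST|//] := eqVneq S T; move: nbS; rewrite ST bT.
have [T'T|neT] := eqVneq T' T; last first.
  by right; exists T' => //; split=> //; rewrite in_fsetU in_fsetD1 neT T'P.
by left; rewrite /P1 in_fsetU in_fset2 -T'T; case: E => ->; rewrite eqxx ?orbT;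
  split=> //; rewrite T'T.
Qed.

End Bisections.

Section Refinement.
Variables (R : realFieldType) (V : lmodType R) (L : seq V).
Hypothesis uniqL : uniq L.
Implicit Types (P Q : {fset nvb V}) (T : nvb V) (C M s : seq V) (a b x : V).

(** [L] will be the sorted list of V_0; the midpoints created by [refinable_step] stay outside
    it. *)
Definition active T : seq V := [seq v <- L | v \in vset T].

Definition well_split T : Prop := exists C M,
  [/\ T = split_nvb C M, uniq (C ++ M) & active T = C \/ active T = rev C].

(** The last clause keeps every vertex of [L] in the mesh; a new midpoint, being no vertex of the
    mesh, therefore cannot belong to [L]. *)
Definition refinable P : Prop :=
  [/\ forall T, T \in P -> well_split T,
      bary_unique (fun S => exists2 T, T \in P & S = vset T) &
      forall v, v \in L -> exists2 T, T \in P & v \in vset T].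

Lemma active_index T a s b x : active T = a :: rcons s b -> x \in L ->
  x \in vset T -> (index a L <= index x L <= index b L)%N.
Proof.
move=> E xL xT.
have : x \in active T by rewrite mem_filter xT.
have : pairwise (fun u v => index u L < index v L)%N (active T).
  apply: pairwise_filter; apply/(pairwiseP 0) => i j; rewrite !inE => iL jL ij.
  by rewrite !index_uniq.
rewrite E /= pairwise_rcons all_rcons => /andP[/andP[ab /allP sa] /andP[/allP sb _]].
rewrite inE mem_rcons inE => /or3P[/eqP ->|/eqP ->|xs]; rewrite ?leqnn ?(ltnW ab) //.
by rewrite (ltnW (sa _ xs)) (ltnW (sb _ xs)).
Qed.

(** With two or more active vertices in a well-split element, this is the distance within [L]
    between the ends of the refinement edge. *)
Definition span T : nat :=
  (index (last 0%R (active T)) L - index (head 0%R (active T)) L)%N.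

(** The active vertices of [T] range over an interval of [L] that contains [a] and [b]. Its length
    is at most their distance by maximality, so [a] and [b] are its ends. *)
Lemma active_edge T0 T a s b : active T0 = a :: rcons s b ->
  ((1 < size (active T))%N -> (span T <= span T0)%N) ->
  a \in vset T -> b \in vset T -> exists s', active T = a :: rcons s' b.
Proof.
move=> E0 le aT bT.
have U : uniq (a :: rcons s b) by rewrite -E0 filter_uniq.
have ab : a != b.
  by apply: contraTneq U => ->; rewrite /= mem_rcons inE eqxx.
have : a \in active T0 by rewrite E0 inE eqxx.
rewrite mem_filter => /andP[aT0 aL].
have : b \in active T0 by rewrite E0 !(inE, mem_rcons) eqxx orbT.
rewrite mem_filter => /andP[bT0 bL].
have aA : a \in active T by rewrite mem_filter aT.
have bA : b \in active T by rewrite mem_filter bT.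
have [c [s' [e E]]] : exists c s' e, active T = c :: rcons s' e.
  case E : (active T) aA bA => [|c t] //; case/lastP: t E => [|s' e] E.
    by rewrite !inE => /eqP ac /eqP bc; rewrite ac bc eqxx in ab.
  by exists c, s', e.
have := le; rewrite /span E E0 /= !last_rcons size_rcons => /(_ isT) {}le.
have /andP[ca ae] := active_index E aL aT; have /andP[cb be] := active_index E bL bT.
have /andP[_ ab'] := active_index E0 aL aT0.
have cA : c \in active T by rewrite E inE eqxx.
have eA : e \in active T by rewrite E !(inE, mem_rcons) eqxx orbT.
move: cA eA; rewrite !mem_filter => /andP[_ cL] /andP[_ eL].
have ord (p q r t : nat) : (p <= q)%N -> (r <= t)%N -> (t - p <= r - q)%N ->
  (q <= r)%N -> p = q /\ t = r by lia.
have [Ec Ee] := ord _ _ _ _ ca be le ab'.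
have Ec' : c = a by rewrite -(nth_index 0 cL) Ec nth_index.
have Ee' : e = b by rewrite -(nth_index 0 eL) Ee nth_index.
by exists s'; rewrite Ec' Ee'.
Qed.

(** The termination measure: edges with both ends in [L], as ordered pairs and together with the
    diagonal. *)
Definition active_pairs P : {fset V * V} :=
  [fset p in [fset v in L] `*` [fset v in L] |
     has (fun T => (p.1 \in vset T) && (p.2 \in vset T)) P].

Lemma in_active_pairs P x y : reflect
  ([/\ x \in L, y \in L & exists T, [/\ T \in P, x \in vset T & y \in vset T]])
  ((x, y) \in active_pairs P).
Proof.
rewrite /active_pairs !inE /= -andbA; apply: (iffP and3P).
  by case=> xL yL /hasP[T TP /andP[xT yT]]; split=> //; exists T.
by case=> xL yL [T [TP xT yT]]; split=> //; apply/hasP; exists T; rewrite ?xT.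
Qed.

Lemma active_fsetU1D1 T T' m e : m \notin L -> vset T' = m |` (vset T `\ e) ->
  active T' = [seq v <- active T | v != e].
Proof.
move=> mL E; rewrite /active -filter_predI; apply: eq_in_filter => v vL /=.
rewrite E in_fset1U in_fsetD1.
by have -> : (v == m) = false by apply: contraNF mL => /eqP <-.
Qed.

(** The element may store its edge as [a, b] or as [b, a], which decides which child loses which
    end. *)
Lemma refinable_children P a b T : refinable P -> T \in P -> a != b ->
  a \in L -> (exists s, active T = a :: rcons s b) ->
  [/\ mid a b \notin L, well_split (child0 T), well_split (child1 T) &
      (vset (child0 T) = mid a b |` (vset T `\ b) /\
       vset (child1 T) = mid a b |` (vset T `\ a)) \/
      (vset (child0 T) = mid a b |` (vset T `\ a) /\
       vset (child1 T) = mid a b |` (vset T `\ b))].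
Proof.
move=> [split_P uniqP coverP] TP ab aL [s0 E].
have [C [M [ET U actT]]] := split_P T TP.
have [c [s [e [EC ce]]]] : exists c s e, C = c :: rcons s e /\
    ((c = a /\ e = b) \/ (c = b /\ e = a)).
  case: actT; rewrite E => EC.
    by exists a, s0, b; split=> //; left.
  exists b, (rev s0), a; split; last by right.
  by rewrite -[C]revK -EC rev_cons rev_rcons.
have Emid : mid c e = mid a b by case: ce => -[-> ->]; rewrite // midC.
subst C.
have G : good (c :: rcons s e) M.
  split=> //; apply: bary_unique_sub uniqP => S <-; exists T => //.
  by rewrite ET.
have mL : mid a b \notin L.
  have : a \in active T by rewrite E inE eqxx.
  have : b \in active T by rewrite E !(inE, mem_rcons) eqxx orbT.
  rewrite !mem_filter => /andP[bT _] /andP[aT _].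
  apply/negP => /coverP[T' T'P]; apply/negP.
  by apply: (mid_notin uniqP _ aT bT ab); [exists T | exists T'].
have V0 : vset (child0 T) = mid a b |` (vset T `\ e).
  by rewrite ET child0_split vset_child0 // Emid.
have V1 : vset (child1 T) = mid a b |` (vset T `\ c).
  by rewrite ET child1_split vset_child1 // Emid.
have [ce' csM esM] := good_ends G.
move: csM esM; rewrite !mem_cat !negb_or => /andP[cs _] /andP[es _].
have f0 : [seq v <- c :: rcons s e | v != e] = c :: s.
  by rewrite /= filter_rcons ce' eqxx /= filter_neq_id.
have f1 : [seq v <- c :: rcons s e | v != c] = rcons s e.
  by rewrite /= filter_rcons (eq_sym e c) ce' eqxx /= filter_neq_id.
split=> //.
- exists (c :: s), (mid c e :: M); split.
  + by rewrite ET child0_split.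
  + by case: (good_child0 G).
  + rewrite (active_fsetU1D1 mL V0).
    by case: actT => ->; [left|right]; rewrite ?filter_rev f0.
- exists (e :: rev s), (mid c e :: M); split.
  + by rewrite ET child1_split.
  + by case: (good_child1 G).
  + rewrite (active_fsetU1D1 mL V1).
    case: actT => ->; [right|left]; rewrite ?filter_rev f1 ?rev_rcons //.
    by rewrite rev_cons revK.
- by rewrite V0 V1; case: ce => -[-> ->]; [left|right].
Qed.

Lemma refinable_step P : refinable P ->
  has (fun T => 1 < size (active T))%N P ->
  exists Q, [/\ bisections P Q, refinable Q &
    (#|` active_pairs Q| < #|` active_pairs P|)%N].
Proof.
move=> RP hasT; have [T0 T0P [T0big maxT0]] := seq_argmax span hasT.
have [a [s [b E0]]] : exists a s b, active T0 = a :: rcons s b.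
  case: (active T0) T0big => [|a t] //; case/lastP: t => [|s b] // _.
  by exists a, s, b.
have U0 : uniq (a :: rcons s b) by rewrite -E0 filter_uniq.
have ab : a != b.
  by apply: contraTneq U0 => ->; rewrite /= mem_rcons inE eqxx.
have : a \in active T0 by rewrite E0 inE eqxx.
rewrite mem_filter => /andP[aT0 aL].
have : b \in active T0 by rewrite E0 !(inE, mem_rcons) eqxx orbT.
rewrite mem_filter => /andP[bT0 bL].
(* The elements around the edge of maximal span; by [active_edge] it is the refinement edge of each
   of them. *)
pose bad T := (a \in vset T) && (b \in vset T).
have chP T : T \in P -> bad T -> _ := fun TP bT =>
  refinable_children RP TP ab aL
    (active_edge E0 (maxT0 T TP) (proj1 (andP bT)) (proj2 (andP bT))).
have [mL _ _ _] := chP T0 T0P (introT andP (conj aT0 bT0)).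
have am : (a == mid a b) = false by apply: contraNF mL => /eqP <-.
have bm : (b == mid a b) = false by apply: contraNF mL => /eqP <-.
have [split_P uniqP coverP] := RP.
have [|Q PQ HQ] := @bisect_all _ _ P bad.
  move=> T TP bT; have [_ _ _ H] := chP T TP bT.
  by rewrite /bad; case: H => -[-> ->];
    rewrite !(in_fset1U, in_fsetD1) am bm !eqxx /= !(andbF, andFb).
have QP T : T \in Q -> exists2 T', T' \in P & vset T `<=` mid a b |` vset T'.
  case/HQ => [[TP _]|[T' [T'P bT'] E]].
    by exists T => //; exact: fsubsetU1.
  exists T' => //; have [_ _ _ H] := chP T' T'P bT'.
  by case: E => ->; case: H => -[e0 e1]; rewrite ?e0 ?e1; apply: fsetUS; exact: fsubD1set.
exists Q; split=> //.
  split.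
  - move=> T /HQ[[/split_P //]|[T' [T'P bT'] E]].
    by have [_ w0 w1 _] := chP T' T'P bT'; case: E => ->.
  - apply: bary_unique_sub (bary_unique_stellar uniqP (ex_intro2 _ _ T0 T0P erefl)
      aT0 bT0 ab) => S [T TQ ->].
    case/HQ: TQ => [[TP nbT]|[T' [T'P bT'] E]]; [left|right].
      by split=> //; exists T.
    exists (vset T'); case/andP: (bT') => aT' bT''; split=> //; first by exists T'.
    have [_ _ _ H] := chP T' T'P bT'.
    by case: E => ->; case: H => -[e0 e1]; rewrite ?e0 ?e1; (by left) || by right.
  - move=> v vL; have [T TP vT] := coverP v vL.
    have [bT|nbT] := boolP (bad T); last by exists T => //; apply/HQ; left.
    have [_ _ _ H] := chP T TP bT.
    (* A vertex of a bisected element survives in one child: [a] in the child that loses [b], any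
       other vertex in the child that loses [a]. *)
    have [va|va] := eqVneq v a.
      case: H => -[H0 H1]; [exists (child0 T)|exists (child1 T)].
      + by apply/HQ; right; exists T => //; left.
      + by rewrite H0 in_fset1U in_fsetD1 vT va ab orbT.
      + by apply/HQ; right; exists T => //; right.
      + by rewrite H1 in_fset1U in_fsetD1 vT va ab orbT.
    case: H => -[H0 H1]; [exists (child1 T)|exists (child0 T)].
    + by apply/HQ; right; exists T => //; right.
    + by rewrite H1 in_fset1U in_fsetD1 vT va orbT.
    + by apply/HQ; right; exists T => //; left.
    + by rewrite H0 in_fset1U in_fsetD1 vT va orbT.
(* The only new vertex is the midpoint, which is not in [L], so no pair is gained, while [(a, b)] is
   lost. *)
apply: (@fset_ltn_card _ _ _ (a, b)).
- apply/fsubsetP => -[x y] /in_active_pairs[xL yL [T [TQ xT yT]]].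
  apply/in_active_pairs; split=> //; have [T' T'P /fsubsetP sTT'] := QP T TQ.
  exists T'; split=> //.
    move: (sTT' _ xT); rewrite in_fset1U => /predU1P[xm|//].
    by rewrite -xm xL in mL.
  move: (sTT' _ yT); rewrite in_fset1U => /predU1P[xm|//].
  by rewrite -xm yL in mL.
- by apply/in_active_pairs; split=> //; exists T0.
- apply/negP => /in_active_pairs[_ _ [T [TQ aT bT]]].
  case/HQ: TQ => [[_]|[T' [T'P bT'] E]]; first by rewrite /bad aT bT.
  have [_ _ _ H] := chP T' T'P bT'.
  by move: aT bT; case: E => ->; case: H => -[e0 e1];
    rewrite ?e0 ?e1 !(in_fset1U, in_fsetD1) am bm !eqxx.
Qed.

Lemma refinable_refine P : refinable P ->
  exists Q, [/\ bisections P Q, refinable Q &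
    forall T, T \in Q -> (size (active T) <= 1)%N].
Proof.
have [n] := ubnP #|` active_pairs P|.
elim: n P => // n IHn P; rewrite ltnS => len RP.
have [big|small] := boolP (has (fun T => 1 < size (active T))%N P).
  have [P1 [PP1 RP1 lt1]] := refinable_step RP big.
  have [Q [P1Q RQ small]] := IHn P1 (leq_trans lt1 len) RP1.
  by exists Q; split=> //; apply: bisections_trans P1Q.
exists P; split=> //; first exact: bisections_refl.
move=> T TP; rewrite leqNgt; apply: contra small => big.
by apply/hasP; exists T.
Qed.

Lemma well_split_ty T : well_split T -> (size (active T) <= 1)%N -> ty T = 0%N.
Proof.
move=> [C [M [-> _ act]]]; rewrite leqNgt => /negPf h /=.
by case: act h => ->; rewrite ?size_rev => ->.
Qed.

End Refinement.

(** * The assigned orderings *)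

Section SortAsc.
Variables (V : choiceType) (V0 : {fset V}) (gt : rel V).
Hypothesis gt_total : strict_total_on (mem V0) gt.

(** A sorted list is unique for a total order. All elements and facets thus select from one global
    list, so passing to a facet just deletes a vertex. *)
Lemma sort_asc_fsetI (T : {fset V}) :
  sort_asc gt (T `&` V0) = [seq v <- sort_asc gt V0 | v \in T].
Proof.
case: gt_total => irr tr tot; set le := fun x y => (x == y) || gt y x.
have le_tot : {in V0 &, total le}.
  move=> x y xV yV; rewrite /le (eq_sym y x).
  by have [//|xy] /= := eqVneq x y; rewrite orbC; exact: tot.
have le_tr : {in V0 & &, transitive le}.
  move=> y x z yV xV zV /predU1P[-> //|yx] /predU1P[<-|zy].
    by rewrite /le yx orbT.
  by rewrite /le (tr y z x) ?orbT.
have le_anti : {in V0 &, antisymmetric le}.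
  move=> x y xV yV /andP[/predU1P[//|yx] /predU1P[//|xy]].
  by have := tr y x x yV xV xV xy yx; rewrite (irr x xV).
have allV0 : all (mem V0) V0 by apply/allP.
rewrite /sort_asc -/le (filter_sort_in le_tot le_tr _ allV0).
apply/perm_sort_inP; first by move=> x y; rewrite !in_fsetI => /andP[_ xV] /andP[_ yV]; exact: le_tot.
- by move=> x y z; rewrite !in_fsetI => /andP[_ xV] /andP[_ yV] /andP[_ zV]; exact: le_tr.
- by move=> x y; rewrite !in_fsetI => /andP[_ xV] /andP[_ yV]; exact: le_anti.
apply: uniq_perm; rewrite ?filter_uniq ?fset_uniq // => v.
by rewrite mem_filter in_fsetI.
Qed.

End SortAsc.

Section Assign.
Variables (R : realFieldType) (V : lmodType R) (d : nat) (V0 V1 : {fset V}).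
Variables (gt0 gt1 : rel V).
Hypotheses (d_ge2 : (2 <= d)%N) (disjV : [disjoint V0 & V1]).
Hypothesis gt0_total : strict_total_on (mem V0) gt0.
Hypothesis gt1_total : strict_total_on (mem V1) gt1.
Implicit Types T F : {fset V}.

Local Notation sel0 T := [seq v <- sort_asc gt0 V0 | v \in T].
Local Notation sel1 T := [seq v <- sort_asc gt1 V1 | v \in T].

Lemma perm_sel T : T `<=` V0 `|` V1 -> perm_eq (sel0 T ++ sel1 T) T.
Proof.
move=> /fsubsetP sT; apply: uniq_perm; rewrite ?fset_uniq //.
  rewrite cat_uniq !filter_uniq ?sort_uniq ?fset_uniq //= andbT.
  apply/hasPn => v; rewrite !mem_filter !mem_sort => /andP[_ vV1] /=.
  apply/negP => /andP[_ vV0].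
  by move/fdisjointP: disjV => /(_ v vV0); rewrite vV1.
move=> v; rewrite mem_cat !mem_filter !mem_sort -andb_orr.
by have [/sT|//] := boolP (v \in T); rewrite in_fsetU.
Qed.

Lemma assign_split T : T `<=` V0 `|` V1 -> #|` T| = d.+1 ->
  assign d V0 V1 gt0 gt1 T = split_nvb (sel0 T) (sel1 T).
Proof.
move=> sT cT; have /perm_size := perm_sel sT; rewrite cT size_cat.
have -> : assign d V0 V1 gt0 gt1 T =
    if sel0 T is v0 :: v then NVB (v0 :: sel1 T ++ v) (size (sel1 T) %% d)
    else NVB (sel1 T) 0.
  by rewrite -!sort_asc_fsetI // /assign size_sort.
case: (sel0 T) => [|v0 v] sz.
  by rewrite /split_nvb /= cats0.
rewrite /split_nvb /= take0 /=; congr NVB.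
(* Reduction mod [d] matters only for [q = d], when a single V_0-vertex remains and both types are
   0. *)
have modE (p q : nat) : (p.+1 + q = d.+1)%N ->
    (q %% d)%N = if (1 < p.+1)%N then q else 0%N.
  by case: p => [|p] [<-]; rewrite ?modnn // modn_small // addSn ltnS leq_addl.
exact: modE sz.
Qed.

Lemma good_sel T : T `<=` V0 `|` V1 -> affinely_independent T ->
  good (sel0 T) (sel1 T).
Proof.
move=> sT indT; have pT := perm_sel sT.
split; first by rewrite (perm_uniq pT) fset_uniq.
have E : vset (split_nvb (sel0 T) (sel1 T)) = T.
  by apply/fsetP => v; rewrite in_vset_split (perm_mem pT).
move=> ? ? f g x <- <-; rewrite E; exact: affinely_independent_bary_unique.
Qed.

Lemma vset_assign T : T `<=` V0 `|` V1 -> #|` T| = d.+1 ->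
  vset (assign d V0 V1 gt0 gt1 T) = T.
Proof.
move=> sT cT; rewrite assign_split //; apply/fsetP => v.
by rewrite in_vset_split (perm_mem (perm_sel sT)).
Qed.

Lemma nvb_dim_assign T : T `<=` V0 `|` V1 -> #|` T| = d.+1 ->
  nvb_dim (assign d V0 V1 gt0 gt1 T) = d.
Proof.
by move=> sT cT; rewrite assign_split // nvb_dim_split (perm_size (perm_sel sT)) cT.
Qed.

(** [F] arises from [T] by removing one vertex, and removing it from the lists selected by [T] gives
    those selected by [F], without reference to [T]. *)
Lemma ordering_within_assign T F : T `<=` V0 `|` V1 -> is_simplex d T ->
  F `<=` T -> #|` F| = d ->
  ordering_within (assign d V0 V1 gt0 gt1 T) F (split_nvb (sel0 F) (sel1 F)).
Proof.
move=> sT [cT indT] sFT cF.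
have : #|` T `\` F| = 1%N by rewrite cardfsD (fsetIidPr sFT) cT cF subSnn.
move=> /eqP/cardfs1P[x Ex].
have EF : F = T `\ x by rewrite -Ex fsetDK.
have pT := perm_sel sT.
have xT : x \in sel0 T ++ sel1 T.
  rewrite (perm_mem pT); have : x \in T `\` F by rewrite Ex in_fset1.
  by rewrite in_fsetD => /andP[].
have G := good_sel sT indT.
have sz : (3 <= size (sel0 T ++ sel1 T))%N by rewrite (perm_size pT) cT.
have := ordering_within_split G sz xT.
rewrite -assign_split // vset_assign // -EF /facet_nvb -!filter_predI.
congr (ordering_within _ _ (split_nvb _ _));
  by apply: eq_filter => v /=; rewrite EF in_fsetD1.
Qed.

Lemma weakest_compatibility_assign (Tr : {fset {fset V}}) :
  (forall T, T \in Tr -> T `<=` V0 `|` V1) ->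
  (forall T, T \in Tr -> is_simplex d T) ->
  weakest_compatibility [fset assign d V0 V1 gt0 gt1 T | T in Tr].
Proof.
move=> sTr simpl _ _ F /imfsetP[T /= TTr ->] /imfsetP[T' /= TTr' ->] _.
have [cT _] := simpl T TTr; have [cT' _] := simpl T' TTr'.
have sT := sTr T TTr; have sT' := sTr T' TTr'.
rewrite !vset_assign // nvb_dim_assign // => -[_ FT FT' _] cF.
exists (split_nvb (sel0 F) (sel1 F)), (split_nvb (sel0 F) (sel1 F)); split.
- exact: ordering_within_assign (simpl T TTr) _ _.
- exact: ordering_within_assign (simpl T' TTr') _ _.
- by split=> //; exact: btree_equiv_refl.
Qed.

Lemma refinable_assign (Tr : {fset {fset V}}) :
  (forall T, T \in Tr -> T `<=` V0 `|` V1) ->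
  (forall T, T \in Tr -> is_simplex d T) ->
  {subset V0 <= fcover Tr} -> conforming Tr ->
  refinable (sort_asc gt0 V0) [fset assign d V0 V1 gt0 gt1 T | T in Tr].
Proof.
move=> sTr simpl covV0 conf.
have vs T : T \in Tr -> vset (assign d V0 V1 gt0 gt1 T) = T.
  by move=> TTr; have [cT _] := simpl T TTr; rewrite vset_assign ?sTr.
split.
- move=> _ /imfsetP[T /= TTr ->]; have [cT indT] := simpl T TTr.
  exists (sel0 T), (sel1 T); split.
  + by rewrite assign_split ?sTr.
  + by case: (good_sel (sTr T TTr) indT).
  + by left; rewrite /active vs.
- apply: bary_unique_sub (conforming_bary_unique (fun T TTr => proj2 (simpl T TTr)) conf).
  by move=> S [_ /imfsetP[T /= TTr ->] ->]; rewrite vs.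
- move=> v; rewrite mem_sort => /covV0/bigfcupP[T]; rewrite andbT => TTr vT.
  by exists (assign d V0 V1 gt0 gt1 T); [apply/imfsetP; exists T|rewrite vs].
Qed.

End Assign.

Theorem theorem3p1 (R : realType) (d : nat) (Omega : set 'rV[R]_d)
    (Tr : {fset {fset 'rV[R]_d}}) (V0 V1 : {fset 'rV[R]_d})
    (gt0 gt1 : rel 'rV[R]_d) :
  (2 <= d)%N ->
  is_domain Omega ->
  conforming_triangulation Omega Tr ->
  (V0 `|` V1)%fset = fcover Tr ->
  [disjoint V0 & V1]%fset ->
  strict_total_on (mem V0) gt0 ->
  strict_total_on (mem V1) gt1 ->
  weakly_compatible [fset assign d V0 V1 gt0 gt1 T | T in Tr]%fset.
Proof.
move=> d2 _ [simpl _ conf] cov disjV tot0 tot1.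
have sTr T : T \in Tr -> T `<=` V0 `|` V1.
  by move=> TTr; rewrite cov; apply: bigfcup_sup.
have covV0 : {subset V0 <= fcover Tr}.
  by move=> v vV0; rewrite -cov in_fsetU vV0.
split; first exact: weakest_compatibility_assign.
have uniqL : uniq (sort_asc gt0 V0) by rewrite sort_uniq fset_uniq.
have RP := refinable_assign disjV tot0 tot1 sTr simpl covV0 conf.
have [Q [PQ [split_Q uniqQ _] small]] := refinable_refine uniqL RP.
exists Q; split=> //.
  apply: bary_unique_conforming; apply: bary_unique_sub uniqQ => S.
  by move=> /imfsetP[T /= TQ ->]; exists T.
by move=> T TQ; left; apply: (well_split_ty (split_Q T TQ) (small T TQ)).
Qed.
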